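(* Suppose that $\Phi+\delta_{S_1}$ has bounded level sets. Let $\lambda,\mu>0$. Given any $x^0\in S_1$, let $\{x^k\}$ be the sequence generated by the NPG method (described in the context) applied to the problem $\min_{x\in S_1}F_{\lambda,\mu}(x)$. Then: (i) $\{x^k\}$ is bounded; (ii) any accumulation point $x^*$ of $\{x^k\}$ is a first-order stationary point of $\min_{x\in S_1}F_{\lambda,\mu}(x)$, that is, it satisfies $$0\in\nabla f_{\lambda,\mu}(x^* )+\partial(\Phi+\delta_{S_1})(x^* ).$$
   Context: Standing setting. $\Phi:\mathbb{R}^n\to\mathbb{R}$ is a nonnegative continuous function. $A\in\mathbb{R}^{m\times n}$ has full row rank, $b\in\mathbb{R}^m$, $\sigma\ge 0$, $B\in\mathbb{R}^{\ell\times n}$, $h\in\mathbb{R}^\ell$, and $D$, $d$ are a matrix and a vector of compatible sizes. $S_1=\{x\in\mathbb{R}^n: Dx\le d\}$, $S_2=\{x\in\mathbb{R}^n:\|Ax-b\|\le\sigma,\ Bx\le h\}$, $S=S_1\cap S_2$ (inequalities componentwise, $\|\cdot\|$ Euclidean), and there exists $x_0\in S$ with $\|Ax_0-b\|<\sigma$. $\delta_{S_1}$ is the indicator function ($0$ on $S_1$, $+\infty$ elsewhere); $\Phi+\delta_{S_1}$ has bounded level sets if $\{x\in S_1:\Phi(x)\le\alpha\}$ is bounded for each $\alpha\in\mathbb{R}$. For $\lambda,\mu>0$, $h_{\lambda,\mu}(s)=\lambda\max_{0\le t\le1}\{st-\frac\mu2t^2\}$, $$f_{\lambda,\mu}(x)=h_{\lambda,\mu}(\|Ax-b\|^2-\sigma^2)+\sum_{i=1}^\ell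 h_{\lambda,\mu}([Bx-h]_i),\qquad F_{\lambda,\mu}(x)=f_{\lambda,\mu}(x)+\Phi(x).$$ Limiting subdifferential: for a proper lower semicontinuous $f$, $v\in\partial f(x)$ iff there exist $x^k\to x$ with $f(x^k)\to f(x)$ and $v^k\to v$ such that for every $k$, $\liminf_{z\to x^k, z\ne x^k}\frac{f(z)-f(x^k)-\langle v^k,z-x^k\rangle}{\|z-x^k\|}\ge0$. NPG (nonmonotone proximal gradient) method for $\min_xF(x)=f(x)+P(x)$, here applied with $f=f_{\lambda,\mu}$ and $P=\Phi+\delta_{S_1}$, from the initial point $x^0$: choose $L_{\max}\ge L_{\min}>0$, $\tau>1$, $c>0$ and an integer $M\ge0$ arbitrarily. For $k=0,1,2,\dots$: choose $L_k^0\in[L_{\min},L_{\max}]$ arbitrarily and set $L_k=L_k^0$; (a) compute $u\in\mathrm{Arg\,min}_x\{\langle\nabla f(x^k),x-x^k\rangle+\frac{L_k}2\|x-x^k\|^2+P(x)\}$; (b) if $F(u)\le\max_{\max\{k-M,0\}\le i\le k}F(x^i)-\frac c2\|u-x^k\|^2$, set $x^{k+1}=u$ and proceed to $k+1$; otherwise replace $L_k$ by $\tau L_k$ and return to (a). *)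

(* Defs.v *)
From mathcomp Require Import all_boot all_order all_algebra.
From mathcomp Require Import all_classical all_reals all_analysis.
Set Implicit Arguments.
Unset Strict Implicit.
Unset Printing Implicit Defensive.
Import Order.TTheory GRing.Theory Num.Theory.
Import numFieldNormedType.Exports.
Local Open Scope classical_set_scope.
Local Open Scope ring_scope.

(* R^n is 'cV[R]_n.  The norm `|x| that the library puts on matrices is the
   sup norm: it is used only for the topology and for boundedness, where it
   agrees with the Euclidean norm [l2norm]. *)
Section Euclidean.
Context {R : realType}.

Definition dotp n (u v : 'cV[R]_n) : R := \sum_i u i 0 * v i 0.

Definition l2norm n (u : 'cV[R]_n) : R := Num.sqrt (dotp u u).

Definition gradient n (f : 'cV[R]_n -> R) (x : 'cV[R]_n) : 'cV[R]_n :=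
  \col_i 'D_(delta_mx i 0) f x.

Definition polyhedron p n (D : 'M[R]_(p, n)) (d : 'cV[R]_p) : set 'cV[R]_n :=
  [set x | forall i, (D *m x) i 0 <= d i 0].

End Euclidean.

Section Extended.
Context {R : realType} {n : nat}.
Implicit Types (f : 'cV[R]_n -> \bar R) (x v : 'cV[R]_n).
Local Open Scope ereal_scope.

Definition set_indicator (S : set 'cV[R]_n) x : \bar R :=
  if x \in S then 0 else +oo.

Definition Argmin f : set 'cV[R]_n := [set u | forall z, f u <= f z].

(* As usual, subgradients exist only at points where f is finite.
   x^' is the punctured neighborhood filter at x. *)
Definition regular_subdifferential f x : set 'cV[R]_n :=
  [set v | f x \is a fin_num /\
    0 <= limf_einf
      (fun z => (f z - f x - (dotp v (z - x))%:E) * ((l2norm (z - x))^-1)%:E)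
      x^'].

Definition limiting_subdifferential f x : set 'cV[R]_n :=
  [set v | f x \is a fin_num /\
    exists xs vs : nat -> 'cV[R]_n,
      [/\ xs k @[k --> \oo] --> x,
          f (xs k) @[k --> \oo] --> f x,
          vs k @[k --> \oo] --> v &
          forall k, regular_subdifferential f (xs k) (vs k)]].

End Extended.

Section Penalty.
Context {R : realType} {l m n : nat}.
Variables (A : 'M[R]_(m, n)) (b : 'cV[R]_m) (sigma : R).
Variables (B : 'M[R]_(l, n)) (h : 'cV[R]_l).

Definition residual_set : set 'cV[R]_n :=
  [set x | l2norm (A *m x - b) <= sigma] `&` polyhedron B h.

(* The supremum is over a compact interval, hence is a maximum. *)
Definition smoothed_plus (lambda mu s : R) : R :=
  lambda * sup [set s * t - mu / 2 * t ^+ 2 | t in `[0, 1]].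

Definition penalty (lambda mu : R) (x : 'cV[R]_n) : R :=
  smoothed_plus lambda mu (l2norm (A *m x - b) ^+ 2 - sigma ^+ 2)
  + \sum_i smoothed_plus lambda mu ((B *m x - h) i 0).

End Penalty.

Section NPG.
Context {R : realType} {n : nat}.
Variables (f : 'cV[R]_n -> R) (P : 'cV[R]_n -> \bar R).
Local Open Scope ereal_scope.

Definition composite_objective (x : 'cV[R]_n) : \bar R := (f x)%:E + P x.

Definition prox_model (L : R) (y x : 'cV[R]_n) : \bar R :=
  (dotp (gradient f y) (x - y) + L / 2 * l2norm (x - y) ^+ 2)%R%:E + P x.

(* The natural number subtraction k - M is max{k - M, 0}. *)
Definition npg_accept (c : R) (M : nat) (x : nat -> 'cV[R]_n) (k : nat)
    (u : 'cV[R]_n) : Prop :=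
  composite_objective u <=
    \big[maxe/-oo]_((k - M)%N <= i < k.+1) composite_objective (x i)
    - (c / 2 * l2norm (u - x k) ^+ 2)%R%:E.

(* At outer iteration k, u i is the trial point computed with
   L_k = tau^i * L0; the trials 0, ..., j - 1 are rejected and trial j is
   accepted. *)
Definition npg_step (Lmin Lmax tau c : R) (M : nat) (x : nat -> 'cV[R]_n)
    (k : nat) : Prop :=
  exists (L0 : R) (j : nat) (u : nat -> 'cV[R]_n),
    [/\ (Lmin <= L0 <= Lmax)%R,
        forall i, (i <= j)%N -> Argmin (prox_model (tau ^+ i * L0) (x k)) (u i),
        forall i, (i < j)%N -> ~ npg_accept c M x k (u i),
        npg_accept c M x k (u j) &
        x k.+1 = u j].

Definition npg_sequence (Lmin Lmax tau c : R) (M : nat)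
    (x0 : 'cV[R]_n) (x : nat -> 'cV[R]_n) : Prop :=
  x 0%N = x0 /\ forall k, npg_step Lmin Lmax tau c M x k.

Definition first_order_stationary (x : 'cV[R]_n) : Prop :=
  [set (gradient f x + v)%R | v in limiting_subdifferential P x] 0%R.

End NPG.

(* Main.v *)
(* The penalty f is a sum of convex functions with locally Lipschitz gradients,
   so it satisfies a two-sided descent lemma on bounded sets.  Accepted values
   of F = f + Phi never exceed F(x^0), and f, Phi >= 0, so the iterates stay in
   a level set of Phi on S1, which is bounded.  By the descent lemma every trial
   with L_k >= 2 C + c is accepted, so the accepted L_k are bounded.  The
   nonmonotone descent, with the uniform continuity of F on bounded sets, gives
   |x^{k+1} - x^k| -> 0.  Comparing the prox objective at x^{k+1} with any other
   point shows that -(grad f(x^k) + L_k (x^{k+1} - x^k)) is a regular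
   subgradient of Phi + delta_{S1} at x^{k+1}, and along a convergent
   subsequence these subgradients tend to the negative gradient of f at the
   limit. *)
Require Import Defs.
From mathcomp Require Import all_boot all_order all_algebra.
From mathcomp Require Import all_classical all_reals all_analysis.
From mathcomp Require Import ring lra zify.
Set Implicit Arguments.
Unset Strict Implicit.
Unset Printing Implicit Defensive.
Import Order.TTheory GRing.Theory Num.Theory.
Import numFieldNormedType.Exports.
Local Open Scope classical_set_scope.
Local Open Scope ring_scope.

(** * Sequences with nonmonotone descent *)

Lemma nonmonotone_descent_le (R : realType) (M : nat) (F e : nat -> R) :
  (forall k, 0 <= e k) ->
  (forall k, exists2 i, (k - M <= i <= k)%N & F k.+1 <= F i - e k) ->
  forall k, F k <= F 0%N.
Proof.
move=> e_ge0 descent k.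
have [N leN] := ubnP k; elim: N => // N IH in k leN *.
case: k leN => // k leN; have [i /andP[_ le_ik] leF] := descent k.
have /IH leFi : (i < N)%N by lia.
by have := e_ge0 k; lra.
Qed.

(** [F] is squeezed to its limsup, and then [e k <= F i - F k.+1] is squeezed to 0. The last
    hypothesis abstracts uniform continuity: a small [e k] means a short step, so that [F k] is not
    much below [F k.+1]. *)
Lemma nonmonotone_descent_cvg0 (R : realType) (M : nat) (F e : nat -> R) :
  (forall k, 0 <= F k) -> (forall k, 0 <= e k) ->
  (forall k, exists2 i, (k - M <= i <= k)%N & F k.+1 <= F i - e k) ->
  (forall eps, 0 < eps ->
     exists2 delta, 0 < delta & forall k, e k < delta -> F k.+1 - eps <= F k) ->
  e @ \oo --> 0.
Proof.
move=> F_ge0 e_ge0 descent unif_cont.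
have F_leF0 := nonmonotone_descent_le e_ge0 descent.
pose E := [set y | exists N, forall i, (N <= i)%N -> F i <= y].
have E_lb : has_lbound E.
  by exists 0 => y [N /(_ _ (leqnn N))]; exact: le_trans.
have E_inf : has_inf E.
  by split=> //; exists (F 0%N), 0%N => i _; exact: F_leF0.
(* zeta is the limsup of F. *)
pose zeta := inf E.
have F_upper eps : 0 < eps -> exists N, forall i, (N <= i)%N -> F i <= zeta + eps.
  move=> eps_gt0; have [y [N leFy] /ltW lt_y] := inf_adherent eps_gt0 E_inf.
  by exists N => i /leFy leFi; exact: le_trans lt_y.
(* Otherwise the maximum [m] of [M + 1] consecutive values lies below [zeta]. Each later value is
   bounded by one in the window before it, so none exceeds [m], and [m] belongs to [E]. *)
have window_reaches k : exists2 j, (j <= M)%N & zeta <= F (j + k)%N.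
  apply: contrapT => nowhere.
  have ltF j : (j <= M)%N -> F (j + k)%N < zeta.
    by move=> le_jM; rewrite ltNge; apply/negP => le_zeta; apply: nowhere; exists j.
  pose m := \big[Num.max/F k]_(j < M.+1) F (j + k)%N.
  have lt_m : m < zeta.
    by apply: bigmax_lt => [|j _]; [exact: (ltF 0%N) | apply: ltF; case: j].
  have leFm i : (k <= i)%N -> F i <= m.
    have [N leN] := ubnP i; elim: N => // N IH in i leN * => le_ki.
    have [le_i|lt_i] := leqP i (M + k)%N.
      have lt_iM : (i - k < M.+1)%N by lia.
      rewrite -[i](subnK le_ki).
      exact: (le_bigmax (F k) (fun j : 'I_M.+1 => F (j + k)%N) (Ordinal lt_iM)).
    case: i leN le_ki lt_i => [|i] leN le_ki lt_i; first by [].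
    have [w w_in leF] := descent i.
    have /IH leFw : (w < N)%N by lia.
    have /leFw : (k <= w)%N by lia.
    by have := e_ge0 i; lra.
  have /(ge_inf E_lb) : E m by exists k.
  by rewrite leNgt lt_m.
(* If F (i + 1) is close to zeta, the descent at step i makes e i small, so F i
   is close to zeta too: closeness propagates backwards from any index whose
   value reaches zeta, and every window contains such an index. *)
have F_lower j eps : 0 < eps ->
    exists N, forall i, (N <= i)%N -> zeta <= F (j + i)%N -> zeta - eps <= F i.
  elim: j eps => [|j IH] eps eps_gt0; first by exists 0%N => i _; rewrite add0n; lra.
  have eps2 : 0 < eps / 2 by lra.
  have [delta delta_gt0 uc] := unif_cont _ eps2.
  (* [delta / 3] gives [e i <= F w - F i.+1 <= 2 * eta < delta]; the two halves of [eps] pay for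
     [eta] and for [unif_cont]. *)
  pose eta := Num.min (eps / 2) (delta / 3).
  have eta_gt0 : 0 < eta by rewrite lt_min; apply/andP; split; lra.
  have eta_le1 : eta <= eps / 2 by rewrite ge_min lexx.
  have eta_le2 : eta <= delta / 3 by rewrite ge_min lexx orbT.
  have [N1 low] := IH _ eta_gt0; have [N2 up] := F_upper _ eta_gt0.
  exists (N1 + N2 + M)%N => i le_i le_zeta.
  have le_next : zeta - eta <= F i.+1 by apply: low; [lia | rewrite addnS].
  have [w w_in leF] := descent i.
  have leFw : F w <= zeta + eta by apply: up; lia.
  by have := uc i; suff /[swap]/[apply] : e i < delta; lra.
have F_lower_all eps : 0 < eps ->
    exists N, forall i, (N <= i)%N -> zeta - eps <= F i.
  move=> eps_gt0.
  have [N lowN] := choice (fun j => F_lower j _ eps_gt0).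
  (* The sum dominates each of the [M + 1] thresholds. *)
  exists (\sum_(j < M.+1) N j)%N => i le_i.
  have [j le_jM le_zeta] := window_reaches i.
  apply: (lowN j) le_zeta; apply: leq_trans le_i.
  by rewrite (bigD1 (Ordinal (le_jM : (j < M.+1)%N)))//= leq_addr.
apply/cvgrPdist_le => eps eps_gt0.
have eps2 : 0 < eps / 2 by lra.
have [N1 low] := F_lower_all _ eps2; have [N2 up] := F_upper _ eps2.
exists (N1 + N2 + M)%N => // k /= le_k.
have [w w_in leF] := descent k.
have leFw : F w <= zeta + eps / 2 by apply: up; lia.
have lowFk : zeta - eps / 2 <= F k.+1 by apply: low; lia.
by rewrite sub0r normrN ger0_norm //; lra.
Qed.

(** * Continuity, norms and the inner product *)

Lemma local_lipschitz_continuous (R : realType) (U V : normedModType R)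
    (F : U -> V) :
  (forall K : R, exists2 C : R, 0 <= C &
     forall x y, `|x| <= K -> `|y| <= K -> `|F y - F x| <= C * `|y - x|) ->
  continuous F.
Proof.
move=> lip x; have [C C_ge0 lipC] := lip (`|x| + 1).
apply/cvgrPdist_lt => eps eps_gt0.
(* Radius 1 keeps [y] in the ball where [C] is valid; [C + 1] avoids a division by 0. *)
have r_gt0 : 0 < Num.min 1 (eps / (C + 1)).
  by rewrite lt_min ltr01 divr_gt0 //; lra.
apply/nbhs_normP; exists (Num.min 1 (eps / (C + 1))) => // y /=.
rewrite lt_min => /andP[lt1 lt2].
have yK : `|y| <= `|x| + 1.
  by rewrite -[y](subrK x); apply: (le_trans (ler_normD _ _)); rewrite -normrN opprB; lra.
apply: (le_lt_trans (lipC y x yK _)); first lra.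
rewrite ltr_pdivlMr in lt2; last lra.
by have := normr_ge0 (x - y); nra.
Qed.

Lemma le_coord_norm (R : realType) m n (u : 'M[R]_(m, n)) i j : `|u i j| <= `|u|.
Proof.
rewrite [leRHS]/Num.norm /= mx_normrE.
exact: (le_bigmax 0 (fun ij : 'I_m * 'I_n => `|u ij.1 ij.2|) (i, j)).
Qed.

Lemma norm_le_coord (R : realType) m n (u : 'M[R]_(m, n)) (a : R) :
  0 <= a -> (forall i j, `|u i j| <= a) -> `|u| <= a.
Proof.
move=> a_ge0 le_a; rewrite [leLHS]/Num.norm /= mx_normrE.
exact: bigmax_le.
Qed.

Section EuclideanLemmas.
Context {R : realType} {n : nat}.
Implicit Types u v w : 'cV[R]_n.

Lemma dotpC u v : dotp u v = dotp v u.
Proof. by apply: eq_bigr => i _; rewrite mulrC. Qed.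

Lemma dotpDr u v w : dotp u (v + w) = dotp u v + dotp u w.
Proof. by rewrite -big_split; apply: eq_bigr => i _; rewrite mxE mulrDr. Qed.

Lemma dotpZr (a : R) u v : dotp u (a *: v) = a * dotp u v.
Proof. by rewrite mulr_sumr; apply: eq_bigr => i _; rewrite mxE mulrCA. Qed.

Lemma dotpNr u v : dotp u (- v) = - dotp u v.
Proof. by rewrite -scaleN1r dotpZr mulN1r. Qed.

Lemma dotpBr u v w : dotp u (v - w) = dotp u v - dotp u w.
Proof. by rewrite dotpDr dotpNr. Qed.

Lemma dotpDl u v w : dotp (u + v) w = dotp u w + dotp v w.
Proof. by rewrite dotpC dotpDr !(dotpC w). Qed.

Lemma dotpZl (a : R) u v : dotp (a *: u) v = a * dotp u v.
Proof. by rewrite dotpC dotpZr dotpC. Qed.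

Lemma dotpNl u v : dotp (- u) v = - dotp u v.
Proof. by rewrite dotpC dotpNr dotpC. Qed.

Lemma dotpBl u v w : dotp (u - v) w = dotp u w - dotp v w.
Proof. by rewrite dotpDl dotpNl. Qed.

Lemma dotp0l v : dotp 0 v = 0.
Proof. by rewrite -(scale0r 0) dotpZl mul0r. Qed.

Lemma dotp_delta u i : dotp u (delta_mx i 0) = u i 0.
Proof.
rewrite /dotp (bigD1 i) //= big1 ?addr0 => [|j ne_ji]; rewrite mxE ?eqxx ?mulr1 //.
by rewrite (negPf ne_ji) mulr0.
Qed.

Lemma ler_norm_dotp u v : `|dotp u v| <= n%:R * `|u| * `|v|.
Proof.
apply: (le_trans (ler_norm_sum _ _ _)).
apply: (@le_trans _ _ (\sum_(i < n) `|u| * `|v|)).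
  by apply: ler_sum => i _; rewrite normrM ler_pM // le_coord_norm.
by rewrite sumr_const card_ord -mulrA mulr_natl.
Qed.

Lemma dotp_ge0 u : 0 <= dotp u u.
Proof. by apply: sumr_ge0 => i _; rewrite -expr2 sqr_ge0. Qed.

Lemma sqr_l2norm u : l2norm u ^+ 2 = dotp u u.
Proof. by rewrite sqr_sqrtr // dotp_ge0. Qed.

Lemma norm_le_l2norm u : `|u| <= l2norm u.
Proof.
apply: norm_le_coord => [|i j0]; first exact: sqrtr_ge0.
rewrite ord1 -sqrtr_sqr ler_wsqrtr // /dotp (bigD1 i) //= expr2 lerDl.
by apply: sumr_ge0 => j _; rewrite -expr2 sqr_ge0.
Qed.

Lemma l2norm_le_norm u : l2norm u <= Num.sqrt n%:R * `|u|.
Proof.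
have -> : Num.sqrt n%:R * `|u| = Num.sqrt (n%:R * `|u| * `|u|).
  by rewrite -mulrA sqrtrM // -expr2 sqrtr_sqr normr_id.
by apply/ler_wsqrtr/(le_trans (ler_norm _)); exact: ler_norm_dotp.
Qed.

End EuclideanLemmas.

(** * Functions with locally Lipschitz gradient *)

Section C11.
Context {R : realType} {n : nat}.
Implicit Types (f : 'cV[R]_n -> R) (g : 'cV[R]_n -> 'cV[R]_n) (x y v : 'cV[R]_n).

(* Two-sided descent lemma: f is differentiable with locally Lipschitz
   gradient g. *)
Definition quad_approx f g := forall K : R, exists2 C : R, 0 <= C &
  forall x y, `|x| <= K -> `|y| <= K ->
    `|f y - f x - dotp (g x) (y - x)| <= C * `|y - x| ^+ 2.

(* Expanding f (y + w) around y and around x bounds <g y - g x, w>; take w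
   along a coordinate with |w| = |y - x|. *)
Lemma quad_approx_lipschitz f g : quad_approx f g -> forall K : R,
  exists2 C : R, 0 <= C &
  forall x y, `|x| <= K -> `|y| <= K -> `|g y - g x| <= C * `|y - x|.
Proof.
(* The ball of radius [3 * K] contains [y + w], as [w] has norm at most [2 * K]. The factor 6 is 1 +
   1 + 4, from three expansions with increments of norm at most [r], [r] and [2 * r]. *)
move=> fg K; have [C C_ge0 approx] := fg (3 * K).
exists (6 * C) => [|x y xK yK]; first by rewrite mulr_ge0.
have le_yx : `|y - x| <= 2 * K.
  by apply: (le_trans (ler_normB _ _)); lra.
have [->|ne_yx] := eqVneq y x; first by rewrite !subrr !normr0 mulr0.
have r_gt0 : 0 < `|y - x| by rewrite normr_gt0 subr_eq0.
set r := `|y - x| in le_yx r_gt0 *.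
apply: norm_le_coord => [|i j]; first by rewrite !mulr_ge0 ?(ltW r_gt0).
rewrite ord1 {j}.
pose w : 'cV[R]_n := r *: delta_mx i 0.
have w_le : `|w| <= r.
  apply: norm_le_coord => [|j j0]; first exact: ltW.
  rewrite !mxE normrM gtr0_norm // ler_piMr ?(ltW r_gt0) // normr_nat.
  by case: (_ && _); rewrite ?lexx ?ler01.
have wK : `|y + w| <= 3 * K.
  by apply: (le_trans (ler_normD _ _)); lra.
have xK' : `|x| <= 3 * K by have := normr_ge0 x; lra.
have yK' : `|y| <= 3 * K by have := normr_ge0 y; lra.
have := approx x (y + w) xK' wK; have := approx y (y + w) yK' wK.
have := approx x y xK' yK'.
have -> : y + w - y = w by rewrite addrC addKr.
have -> : y + w - x = (y - x) + w by rewrite addrAC.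
rewrite (dotpDr _ (y - x) w) -/r => a1 a2 a3.
have b2 : C * `|w| ^+ 2 <= C * r ^+ 2.
  by rewrite ler_wpM2l // ler_sqr ?nnegrE ?(ltW r_gt0).
have b3 : C * `|y - x + w| ^+ 2 <= C * (2 * r) ^+ 2.
  rewrite ler_wpM2l // ler_sqr ?nnegrE ?mulr_ge0 ?(ltW r_gt0) //.
  by apply: (le_trans (ler_normD _ _)); rewrite -/r; lra.
have key : `|dotp (g y - g x) w| <= 6 * C * r ^+ 2.
  move: (le_trans a2 b2) (le_trans a3 b3) a1; rewrite dotpBl !ler_norml exprMn.
  by move=> /andP[? ?] /andP[? ?] /andP[? ?]; apply/andP; split; lra.
rewrite /w dotpZr dotp_delta normrM gtr0_norm // in key.
by rewrite -(ler_pM2l r_gt0); apply: (le_trans key); rewrite expr2; lra.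
Qed.

Lemma quad_approx_bounded f g : quad_approx f g -> forall K : R,
  exists2 G : R, 0 <= G & forall x, `|x| <= K -> `|g x| <= G.
Proof.
move=> fg K; have [C C_ge0 lip] := quad_approx_lipschitz fg K.
(* The absolute value keeps the bound nonnegative for negative [K], where the ball is empty. *)
exists (C * `|K| + `|g 0|) => [|x xK]; first by rewrite addr_ge0 ?mulr_ge0.
have K_ge0 : 0 <= K by apply: le_trans xK.
rewrite -[g x](subrK (g 0)); apply: (le_trans (ler_normD _ _)).
rewrite lerD2r; apply: le_trans (lip 0 x _ xK) _; first by rewrite normr0.
by rewrite subr0 ler_wpM2l // (le_trans xK) // ler_norm.
Qed.

Lemma quad_approx_lipschitz_fun f g : quad_approx f g -> forall K : R,
  exists2 C : R, 0 <= C &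
  forall x y, `|x| <= K -> `|y| <= K -> `|f y - f x| <= C * `|y - x|.
Proof.
move=> fg K; have [C C_ge0 approx] := fg K.
have [G G_ge0 gG] := quad_approx_bounded fg K.
exists (C * (2 * `|K|) + n%:R * G) => [|x y xK yK].
  by rewrite addr_ge0 ?mulr_ge0.
rewrite -[f y - f x](subrK (dotp (g x) (y - x))).
apply: (le_trans (ler_normD _ _)); rewrite mulrDl lerD //.
  apply: (le_trans (approx _ _ xK yK)).
  rewrite expr2 mulrA ler_wpM2r // ler_wpM2l //.
  apply: (le_trans (ler_normB _ _)).
  by have := ler_norm K; lra.
apply: (le_trans (ler_norm_dotp _ _)).
by rewrite ler_wpM2r // ler_wpM2l // gG.
Qed.

(** The difference quotient along [v] differs from [dotp (g x) v] by at most a constant times the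
    size of [t]. Thus any [g] produced by the closure rules below is the gradient that the prox
    model uses. *)
Lemma quad_approx_gradient f g : quad_approx f g -> gradient f = g.
Proof.
move=> fg; apply/funext => x; apply/colP => i; rewrite mxE -(dotp_delta (g x)).
set v := delta_mx i 0; have [C C_ge0 approx] := fg (`|x| + `|v|).
apply/cvg_lim; first exact: norm_hausdorff.
apply/cvgrPdist_lt => eps eps_gt0.
have B_ge0 : 0 <= C * `|v| ^+ 2 by rewrite mulr_ge0 // sqr_ge0.
near=> t.
have t_neq0 : t != 0 by near: t; exact: nbhs_dnbhs_neq.
have t_gt0 : 0 < `|t| by rewrite normr_gt0.
have t_lt : `|t| < Num.min 1 (eps / (C * `|v| ^+ 2 + 1)).
  near: t; apply: dnbhs0_lt.
  by rewrite lt_min ltr01 divr_gt0 //; lra.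
move: t_lt; rewrite lt_min => /andP[t_lt1]; rewrite ltr_pdivlMr; last lra.
move=> t_lt.
have := approx x (t *: v + x); rewrite lerDl normr_ge0 addrK dotpZr => /(_ isT).
have tvx : `|t *: v + x| <= `|x| + `|v|.
  apply: (le_trans (ler_normD _ _)); rewrite addrC lerD2l normrZ.
  by rewrite ler_piMl // ltW.
move=> /(_ tvx) le_approx.
have -> : dotp (g x) v - t^-1 *: (f (t *: v + x) - f x)
    = - (t^-1 * (f (t *: v + x) - f x - t * dotp (g x) v)).
  by rewrite /GRing.scale /=; field.
rewrite normrN normrM normfV mulrC ltr_pdivrMr //.
apply: (le_lt_trans le_approx); rewrite normrZ.
by nra.
Unshelve. all: by end_near. Qed.

Lemma quad_approx_add f1 g1 f2 g2 : quad_approx f1 g1 -> quad_approx f2 g2 ->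
  quad_approx (fun x => f1 x + f2 x) (fun x => g1 x + g2 x).
Proof.
move=> fg1 fg2 K; have [C1 C1_ge0 a1] := fg1 K; have [C2 C2_ge0 a2] := fg2 K.
exists (C1 + C2) => [|x y xK yK]; first exact: addr_ge0.
rewrite mulrDl; apply: le_trans (lerD (a1 x y xK yK) (a2 x y xK yK)).
by apply: le_trans (ler_normD _ _); rewrite dotpDl le_eqVlt; apply/orP; left;
  apply/eqP; congr `|_|; ring.
Qed.

Lemma quad_approx_affine (a : 'cV[R]_n) f (b : R) :
  (forall x, f x = dotp a x + b) -> quad_approx f (fun=> a).
Proof.
move=> fE K; exists 0 => // x y _ _; rewrite !fE dotpBr mul0r.
by rewrite [X in `|X|](_ : _ = 0) ?normr0 //; ring.
Qed.

Lemma quad_approx_sum (I : Type) (s : seq I) (f : I -> 'cV[R]_n -> R)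
    (g : I -> 'cV[R]_n -> 'cV[R]_n) :
  (forall i, quad_approx (f i) (g i)) ->
  quad_approx (fun x => \sum_(i <- s) f i x) (fun x => \sum_(i <- s) g i x).
Proof.
move=> fg; elim: s => [|i s IH].
  move=> K; exists 0 => // x y _ _.
  by rewrite !big_nil dotp0l mul0r !subr0 normr0.
move=> K; have [C C_ge0 approx] := quad_approx_add (fg i) IH K.
by exists C => // x y; rewrite !big_cons; exact: approx.
Qed.

(** The error splits into that of [phi] at [f x], quadratic because [f] is Lipschitz on balls, and
    [r (f x)] times that of [f]. Linear growth of the derivative [r] covers both the square and
    [smoothed_plus]. *)
Lemma quad_approx_comp (phi r : R -> R) (a b : R) f g :
  0 <= a -> 0 <= b ->
  (forall s t, `|phi t - phi s - r s * (t - s)| <= a * (t - s) ^+ 2) ->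
  (forall s, `|r s| <= b * (1 + `|s|)) ->
  quad_approx f g ->
  quad_approx (phi \o f) (fun x => r (f x) *: g x).
Proof.
move=> a_ge0 b_ge0 phi_approx r_growth fg K.
have [C C_ge0 approx] := fg K.
have [L L_ge0 lip] := quad_approx_lipschitz_fun fg K.
(* Bounds 1 plus the absolute value of [f] on the ball of radius [K]. *)
pose Q := 1 + (`|f 0| + L * `|K|).
have Q_ge0 : 0 <= Q by rewrite !addr_ge0 ?mulr_ge0.
exists (a * L ^+ 2 + b * Q * C) => [|x y xK yK].
  by rewrite addr_ge0 ?mulr_ge0 ?sqr_ge0.
have K_ge0 : 0 <= K by apply: le_trans xK.
have rQ : `|r (f x)| <= b * Q.
  apply: (le_trans (r_growth _)); rewrite ler_wpM2l // lerD2l.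
  rewrite -[f x](subrK (f 0)) addrC; apply: (le_trans (ler_normD _ _)).
  rewrite lerD2l; apply: le_trans (lip 0 x _ xK) _; first by rewrite normr0.
  by rewrite subr0 ler_wpM2l // (le_trans xK) // ler_norm.
have -> : (phi \o f) y - (phi \o f) x - dotp (r (f x) *: g x) (y - x)
  = (phi (f y) - phi (f x) - r (f x) * (f y - f x))
    + r (f x) * (f y - f x - dotp (g x) (y - x)).
  by rewrite dotpZl /=; ring.
apply: (le_trans (ler_normD _ _)); rewrite mulrDl lerD //.
  apply: (le_trans (phi_approx _ _)); rewrite -mulrA ler_wpM2l //.
  rewrite -exprMn -real_normK ?num_real // ler_sqr ?nnegrE ?mulr_ge0 //.
  exact: lip.
by rewrite normrM -mulrA ler_pM // approx.
Qed.

End C11.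

(** * The smoothed penalty *)

Section Penalty.
Context {R : realType}.
Implicit Types lambda mu s t : R.

(** Projection onto [0, 1]; [clamp01 (s / mu)] attains the maximum in [smoothed_plus]. *)
Definition clamp01 (s : R) : R := Num.min 1 (Num.max 0 s).

Lemma clamp01_itv s : 0 <= clamp01 s <= 1.
Proof. by rewrite le_min ler01 le_max lexx ge_min lexx. Qed.

(* Variational inequality for the maximizer clamp01 (s / mu). *)
Lemma clamp01_optimal mu s t : 0 < mu -> 0 <= t <= 1 ->
  (s - mu * clamp01 (s / mu)) * (t - clamp01 (s / mu)) <= 0.
Proof.
move=> mu_gt0 /andP[t_ge0 t_le1]; rewrite /clamp01.
set r := s / mu; have -> : s = mu * r by rewrite /r; field; lra.
rewrite -mulrBr -mulrA (pmulr_rle0 _ mu_gt0).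
have [r_le0|r_gt0] := leP r 0.
  by rewrite min_r ?ler01 //; nra.
by have [|] := leP 1 r => ?; nra.
Qed.

(** Expanding the concave quadratic around [r], its value at [r] exceeds that at [t] by [(s - mu *
    r) * (r - t) + mu / 2 * (t - r) ^+ 2], and both terms are nonnegative. *)
Lemma smoothed_plusE lambda mu s : 0 < mu ->
  smoothed_plus lambda mu s =
  lambda * (s * clamp01 (s / mu) - mu / 2 * clamp01 (s / mu) ^+ 2).
Proof.
move=> mu_gt0; congr (_ * _); set r := clamp01 _.
have r01 := clamp01_itv (s / mu).
set E := [set _ | _ in _].
have E_ub : ubound E (s * r - mu / 2 * r ^+ 2).
  move=> _ [t /= t01 <-]; rewrite in_itv /= in t01.
  have := clamp01_optimal s mu_gt0 t01; rewrite -/r.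
  by have := sqr_ge0 (t - r); nra.
have E_r : E (s * r - mu / 2 * r ^+ 2) by exists r => //=; rewrite in_itv.
apply/le_anti/andP; split; first by apply: ge_sup => //; exists (s * r - mu / 2 * r ^+ 2).
by apply: ub_le_sup => //; exists (s * r - mu / 2 * r ^+ 2).
Qed.

Lemma smoothed_plus_ge0 lambda mu s : 0 <= lambda -> 0 < mu ->
  0 <= smoothed_plus lambda mu s.
Proof.
move=> lambda_ge0 mu_gt0; rewrite smoothed_plusE // mulr_ge0 //.
have := clamp01_optimal s mu_gt0 (_ : 0 <= 0 <= 1); rewrite lexx ler01 => /(_ isT).
by have := sqr_ge0 (clamp01 (s / mu)); nra.
Qed.

(** The error is nonnegative by optimality of [q] for [t]. Optimality of [r] for [s] bounds it, up
    to [lambda], by [(q - r) * (t - s) - mu / 2 * (q - r) ^+ 2], and completing the square gives the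
    constant. *)
Lemma smoothed_plus_approx lambda mu s t : 0 <= lambda -> 0 < mu ->
  `|smoothed_plus lambda mu t - smoothed_plus lambda mu s
    - lambda * clamp01 (s / mu) * (t - s)| <= lambda / (2 * mu) * (t - s) ^+ 2.
Proof.
move=> lambda_ge0 mu_gt0; rewrite !smoothed_plusE //.
have := clamp01_optimal s mu_gt0 (clamp01_itv (t / mu)).
have := clamp01_optimal t mu_gt0 (clamp01_itv (s / mu)).
set r := clamp01 (s / mu); set q := clamp01 (t / mu) => opt_t opt_s.
have -> : lambda * (t * q - mu / 2 * q ^+ 2) - lambda * (s * r - mu / 2 * r ^+ 2)
    - lambda * r * (t - s)
  = lambda * (t * (q - r) - mu / 2 * (q ^+ 2 - r ^+ 2)) by ring.
rewrite normrM ger0_norm // -!mulrA ler_wpM2l //.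
have sq : 0 <= (2 * mu)^-1 * (mu * (q - r) - (t - s)) ^+ 2.
  by rewrite mulr_ge0 ?sqr_ge0 // invr_ge0; lra.
have sqE : (2 * mu)^-1 * (mu * (q - r) - (t - s)) ^+ 2
   = mu / 2 * (q - r) ^+ 2 - (q - r) * (t - s) + (2 * mu)^-1 * (t - s) ^+ 2.
  by field; lra.
rewrite sqE in sq.
have mu_sq : 0 <= mu / 2 * (q - r) ^+ 2 by rewrite mulr_ge0 ?sqr_ge0 //; lra.
by rewrite ger0_norm; lra.
Qed.

Lemma penalty_ge0 l m n (A : 'M[R]_(m, n)) b sigma (B : 'M[R]_(l, n)) h
    lambda mu x : 0 <= lambda -> 0 < mu -> 0 <= penalty A b sigma B h lambda mu x.
Proof.
move=> lambda_ge0 mu_gt0; apply: addr_ge0; first exact: smoothed_plus_ge0.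
by apply: sumr_ge0 => i _; exact: smoothed_plus_ge0.
Qed.

(** The penalty is assembled from the affine rows by squares, sums and [smoothed_plus], each of
    which preserves [quad_approx]. *)
Lemma penalty_quad_approx l m n (A : 'M[R]_(m, n)) b sigma (B : 'M[R]_(l, n)) h
    lambda mu : 0 <= lambda -> 0 < mu ->
  exists g, quad_approx (penalty A b sigma B h lambda mu) g.
Proof.
move=> lambda_ge0 mu_gt0.
have rowE k (N : 'M[R]_(k, n)) (e : 'cV[R]_k) i x :
    (N *m x - e) i 0 = dotp (row i N)^T x + - e i 0.
  by rewrite !mxE; congr (_ + _); apply: eq_bigr => j _; rewrite !mxE.
have coef_ge0 : 0 <= lambda / (2 * mu) by rewrite divr_ge0 //; lra.
have smoothed (f : 'cV[R]_n -> R) g :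
    quad_approx f g -> quad_approx (smoothed_plus lambda mu \o f)
      (fun x => (lambda * clamp01 (f x / mu)) *: g x).
  apply: (@quad_approx_comp _ _ _ (fun s => lambda * clamp01 (s / mu))
            (lambda / (2 * mu)) lambda) => // [s t|s]; first exact: smoothed_plus_approx.
  have /andP[? ?] := clamp01_itv (s / mu).
  by rewrite ger0_norm ?mulr_ge0 // ler_wpM2l // ler_wpDr.
have squared (f : 'cV[R]_n -> R) g : quad_approx f g ->
    quad_approx ((fun s => s ^+ 2) \o f) (fun x => (2 * f x) *: g x).
  apply: (@quad_approx_comp _ _ _ (fun s => 2 * s) 1 2) => // [s t|s].
    by rewrite mul1r ger0_norm; have := sqr_ge0 (t - s); lra.
  by rewrite normrM ger0_norm // ler_wpM2l // lerDr.
have affine k (N : 'M[R]_(k, n)) e i := quad_approx_affine (rowE k N e i).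
(* The gradient is left to unification: each closure rule supplies its piece. *)
eexists; apply: quad_approx_add; last first.
  by apply: quad_approx_sum => i; exact/smoothed/affine.
apply: (smoothed (fun x => l2norm (A *m x - b) ^+ 2 - sigma ^+ 2)).
apply: quad_approx_add; last first.
  by apply: (@quad_approx_affine _ _ 0 _ (- sigma ^+ 2)) => x; rewrite dotp0l add0r.
under eq_fun do rewrite sqr_l2norm /dotp.
by apply: quad_approx_sum => i; exact/squared/affine.
Qed.

End Penalty.

(** * Compactness and uniform continuity *)

(** Compactness is carried over from row vectors by transposition, an isometry for the sup norm. *)
Lemma bounded_cV_compact (R : realType) n (K : R) :
  compact [set x : 'cV[R]_n | `|x| <= K].
Proof.
have tr_le k m (y : 'M[R]_(k, m)) : `|y^T| <= `|y|.
  by apply: norm_le_coord => // i j; rewrite mxE; exact: le_coord_norm.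
have tr_norm k m (y : 'M[R]_(k, m)) : `|y^T| = `|y|.
  by apply/le_anti; rewrite tr_le -{1}(trmxK y) tr_le.
have -> : [set x : 'cV[R]_n | `|x| <= K]
    = trmx @` [set y : 'rV[R]_n | `|y| <= K].
  apply/seteqP; split=> [x /= xK|_ [y /= yK <-]]; last by rewrite tr_norm.
  by exists x^T; rewrite ?trmxK //= -tr_norm trmxK.
apply: continuous_compact.
  apply: continuous_subspaceT; apply: local_lipschitz_continuous => K'.
  by exists 1 => // x y _ _; rewrite mul1r -raddfB /= tr_norm.
apply: bounded_closed_compact.
  exists K; split; first exact: num_real.
  by move=> M ltKM y /= yK; apply: le_trans (ltW ltKM).
exact: closed_comp (fun y _ => @norm_continuous _ _ y) (@closed_le _ K).
Qed.

(** Only [x] ranges over the compact set, so continuity is assumed on the whole space. Compactness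
    is used as near covering, with the modulus ranging over the filter of small positive reals. *)
Lemma compact_unif_continuous (R : realType) (V : normedModType R) (A : set V)
    (F : V -> R) (eps : R) :
  compact A -> continuous F -> 0 < eps ->
  exists2 delta, 0 < delta &
    forall x y, A x -> `|x - y| < delta -> `|F x - F y| < eps.
Proof.
move=> /compact_near_coveringP + F_cont eps_gt0.
move=> /(_ _ (0 : R)^'+ (fun d x => forall y, `|x - y| < d -> `|F x - F y| < eps)).
case=> [x _|delta /= delta_gt0 cover].
  have eps2 : 0 < eps / 2 by lra.
  have /cvgrPdist_lt/(_ _ eps2)/nbhs_normP[d /= d_gt0 near_x] := F_cont x.
  (* Both radii are [d / 2], so the point [y] lies within [d] of the center [x]. *)
  exists (ball x (d / 2), [set e | 0 < e < d / 2]) => /=.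
    split; first by apply: nbhsx_ballx; lra.
    exists (d / 2) => /=; first lra.
    by move=> e /=; rewrite sub0r normrN => lt_e e_gt0;
      rewrite e_gt0 (le_lt_trans (ler_norm _)).
  move=> [x' e] /= [x'B /andP[e_gt0 e_lt]] y xy.
  rewrite -ball_normE /= in x'B.
  have F1 : `|F x - F x'| < eps / 2 by apply: near_x => /=; lra.
  have F2 : `|F x - F y| < eps / 2.
    apply: near_x => /=; rewrite -[x - y](subrKA x').
    by apply: (le_lt_trans (ler_normD _ _)); lra.
  rewrite -[F x' - F y](subrKA (F x)).
  by apply: (le_lt_trans (ler_normD _ _)); rewrite distrC; lra.
exists (delta / 2) => [|x y Ax xy]; first lra.
apply: (cover (delta / 2)) => //; last lra.
by rewrite /= sub0r normrN gtr0_norm; lra.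
Qed.

(** * Regular subgradients from quadratic minorants *)

Section Subdifferential.
Context {R : realType} {n : nat}.

(** The quotient in the lower limit is at least [- L * l2norm (z - u)], which tends to 0; hence its
    infimum over the punctured neighborhood [V] is at least [- eps]. *)
Lemma quad_minorant_regular (P : 'cV[R]_n -> \bar R) (u v : 'cV[R]_n) (L : R) :
  P u \is a fin_num ->
  (forall z, P u + (dotp v (z - u) - L * l2norm (z - u) ^+ 2)%:E <= P z)%E ->
  regular_subdifferential P u v.
Proof.
move=> Pu_fin minorant; split=> //; rewrite limf_einfE.
apply/lee_addgt0Pr => eps eps_gt0.
rewrite -leeBlDr // add0e.
pose phi z := ((P z - P u - (dotp v (z - u))%:E) * (l2norm (z - u))^-1%:E)%E.
pose V := [set z | z != u /\ L * l2norm (z - u) <= eps].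
have V_near : u^' V.
  (* The square root passes from the sup norm to the Euclidean norm; adding 1 makes [c] positive. *)
  pose c := `|L| * Num.sqrt n%:R + 1.
  have c_gt0 : 0 < c by rewrite ltr_wpDl ?mulr_ge0.
  apply: (@nbhs_normP R 'cV[R]_n u (fun z => z != u -> V z)).2.
  exists (eps / c) => [|z /= zu z_neq]; first by rewrite /= divr_gt0.
  split=> //.
  rewrite ltr_pdivlMr // distrC in zu.
  apply: (le_trans (ler_norm _)); rewrite normrM (ger0_norm (sqrtr_ge0 _)).
  apply: (@le_trans _ _ (`|L| * (Num.sqrt n%:R * `|z - u|))).
    by rewrite ler_wpM2l // l2norm_le_norm.
  by apply: le_trans (ltW zu); rewrite /c; have := normr_ge0 (z - u); lra.
apply: (@le_trans _ _ (ereal_inf (phi @` V))); last first.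
  by apply: ereal_sup_ubound; exists V.
apply: le_ereal_inf_tmp => _ [z [z_neq Lz] <-]; rewrite /phi.
have r_gt0 : 0 < l2norm (z - u).
  by apply: lt_le_trans (norm_le_l2norm _); rewrite normr_gt0 subr_eq0.
move: (minorant z) Pu_fin; case: (P u) => // p + _.
case: (P z) => [q||]; first last.
- by rewrite -EFinD leeNy_eq.
- move=> _; have -> : (+oo - p%:E - (dotp v (z - u))%:E = +oo)%E by [].
  by rewrite mulyr gtr0_sg ?invr_gt0 // mul1e leey.
rewrite -!EFinD -EFinM !lee_fin => le_q.
rewrite ler_pdivlMr // mulNr; apply: (@le_trans _ _ (- (L * l2norm (z - u) ^+ 2))).
  by rewrite lerN2 expr2 mulrA ler_wpM2r // ltW.
by lra.
Qed.

End Subdifferential.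

(** * Window maxima and convergence along subsequences *)

Lemma bigmaxe_attained (R : realType) (s : seq nat) (F : nat -> \bar R) :
  (\big[maxe/-oo]_(i <- s) F i = -oo)%E \/
  exists2 i, i \in s & (\big[maxe/-oo]_(i <- s) F i = F i)%E.
Proof.
elim: s => [|i s IH]; first by left; rewrite big_nil.
right; rewrite big_cons; case: IH => [->|[j js ->]].
  by exists i; rewrite ?mem_head // maxeNy.
have [_|_] := leP (F i) (F j); first by exists j; rewrite // inE js orbT.
by exists i; rewrite ?mem_head.
Qed.

Lemma cvg_dist_le (R : realType) (V : normedModType R) (u : nat -> V) (a : V)
    (r : nat -> R) :
  (forall k, `|u k - a| <= r k) -> r @ \oo --> 0 -> u @ \oo --> a.
Proof.
move=> le_r r0; apply/cvgrPdist_le => eps eps_gt0.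
move/cvgrPdist_le: r0 => /(_ _ eps_gt0); apply: filterS => k.
rewrite sub0r normrN => le_eps.
by rewrite distrC (le_trans (le_r k)) // (le_trans (ler_norm _)).
Qed.

(** [j <= ks j] lets limits of the whole sequence pass to the indices [ks j]; the explicit rate
    feeds [cvg_dist_le]. *)
Lemma cluster_seq_sub (R : realType) (V : normedModType R) (x : nat -> V) (a : V) :
  cluster (x k @[k --> \oo]) a ->
  exists2 ks : nat -> nat, forall j, (j <= ks j)%N &
    forall j, `|x (ks j) - a| <= harmonic j :> R.
Proof.
move=> clu; suff /choice[ks ksP] : forall j, exists k,
    (j <= k)%N /\ `|x k - a| <= harmonic j :> R.
  by exists ks => j; have [] := ksP j.
move=> j; have h_gt0 : 0 < harmonic j :> R by rewrite invr_gt0.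
have /clu/(_ (nbhsx_ballx a _ h_gt0)) : (x k @[k --> \oo]) (x @` [set k | (j <= k)%N]).
  by exists j => // k /= jk; exists k.
case=> _ [[k jk <-]]; rewrite -ball_normE /= => /ltW; rewrite distrC.
by exists k.
Qed.

(** * Convergence of the NPG method *)

Section NPGConvergence.
Context {R : realType} {n : nat} (f Phi : 'cV[R]_n -> R).
Context (g : 'cV[R]_n -> 'cV[R]_n) (S : set 'cV[R]_n).
Context (f_quad : quad_approx f g) (f_ge0 : forall x, 0 <= f x).
Context (Phi_ge0 : forall x, 0 <= Phi x).
Let P x : \bar R := ((Phi x)%:E + set_indicator S x)%E.
Implicit Types (x y u v z : 'cV[R]_n) (xs : nat -> 'cV[R]_n).

Lemma constrained_in y : S y -> P y = (Phi y)%:E.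
Proof. by move=> Sy; rewrite /P /set_indicator mem_set // adde0. Qed.

Lemma constrained_notin y : ~ S y -> P y = +oo%E.
Proof. by move=> nSy; rewrite /P /set_indicator memNset // addey. Qed.

(** The window maximum is attained at a feasible iterate, so it is finite and forces [u] to be
    feasible. A maximum of [-oo] is excluded because the objective never takes that value. *)
Lemma npg_accept_window (c : R) M xs k u :
  (forall i, (i <= k)%N -> S (xs i)) -> npg_accept f P c M xs k u ->
  S u /\ exists2 i, (k - M <= i <= k)%N &
    f u + Phi u <= f (xs i) + Phi (xs i) - c / 2 * l2norm (u - xs k) ^+ 2.
Proof.
move=> Sxs; rewrite /npg_accept.
have [->|[i]] := bigmaxe_attained (index_iota (k - M) k.+1)
  (composite_objective f P \o xs).
  rewrite addNye leeNy_eq /composite_objective.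
  have [Su|nSu] := pselect (S u); first by rewrite constrained_in.
  by rewrite constrained_notin.
rewrite mem_index_iota => /andP[ki ik] -> /=.
rewrite /composite_objective (constrained_in (Sxs i ik)).
have [Su|nSu] := pselect (S u); last by rewrite constrained_notin // addey.
rewrite constrained_in // -!EFinD lee_fin => le_u.
by split=> //; exists i => //; rewrite ki.
Qed.

Lemma npg_accept_sufficient (c : R) M xs k u : S (xs k) -> S u ->
  f u + Phi u <= f (xs k) + Phi (xs k) - c / 2 * l2norm (u - xs k) ^+ 2 ->
  npg_accept f P c M xs k u.
Proof.
move=> Sxk Su le_u; rewrite /npg_accept leeBrDr //.
have k_in : k \in index_iota (k - M) k.+1 by rewrite mem_index_iota ltnSn leq_subr.
apply: bigmax_sup_seq k_in _ _ => //.
by rewrite /composite_objective !constrained_in // -!EFinD lee_fin; lra.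
Qed.

Lemma prox_argmin (L : R) y u : S y -> Argmin (prox_model f P L y) u ->
  S u /\ forall z, S z ->
    dotp (g y) (u - y) + L / 2 * l2norm (u - y) ^+ 2 + Phi u <=
    dotp (g y) (z - y) + L / 2 * l2norm (z - y) ^+ 2 + Phi z.
Proof.
move=> Sy; rewrite /Argmin /prox_model /= (quad_approx_gradient f_quad) => argmin.
have Su : S u.
  apply: contrapT => nSu; have := argmin y.
  by rewrite constrained_notin // addey // constrained_in.
by split=> // z Sz; have := argmin z; rewrite !constrained_in // -!EFinD lee_fin.
Qed.

(** Expanding the squared norm of [z - y] around [u] turns minimality of [u] into a quadratic
    minorant of [P] with constant [L / 2]. *)
Lemma prox_regular_subgradient (L : R) y u : S y ->
  Argmin (prox_model f P L y) u ->
  regular_subdifferential P u (- (g y + L *: (u - y))).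
Proof.
move=> Sy /(prox_argmin Sy)[Su argmin].
apply: (@quad_minorant_regular _ _ _ _ _ (L / 2)) => [|z].
  by rewrite constrained_in.
have [Sz|nSz] := pselect (S z); last by rewrite (constrained_notin nSz) leey.
rewrite !constrained_in // -EFinD lee_fin; have := argmin z Sz.
have -> : z - y = (z - u) + (u - y) by rewrite subrKA.
rewrite !sqr_l2norm dotpNl (dotpDl (g y)) dotpZl (dotpDl (z - u) (u - y)).
rewrite !(dotpDr _ (z - u) (u - y)) (dotpC (z - u) (u - y)).
lra.
Qed.

(** Since [Lmin <= L], all trial points stay within [r] of the current iterate, so one constant [C]
    serves every trial. The last rejected [L] is below [2 * C + c], and the accepted one is [tau]
    times it. *)
Lemma npg_stepsize_bounded (Lmin Lmax tau c K F0 : R) M xs :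
  0 < Lmin -> 1 < tau -> 0 < c ->
  (forall k, S (xs k)) -> (forall k, `|xs k| <= K) -> (forall k, Phi (xs k) <= F0) ->
  (forall k, npg_step f P Lmin Lmax tau c M xs k) ->
  exists Lbar, forall k, exists2 L, 0 <= L <= Lbar &
    Argmin (prox_model f P L (xs k)) (xs k.+1).
Proof.
move=> Lmin_gt0 tau_gt1 c_gt0 Sxs xsK PhiF0 step.
have [G G_ge0 gG] := quad_approx_bounded f_quad K.
have F0_ge0 : 0 <= F0 := le_trans (Phi_ge0 _) (PhiF0 0%N).
pose H := n%:R * G; have H_ge0 : 0 <= H by rewrite mulr_ge0.
(* A trial at distance [q] satisfies [Lmin / 2 * q ^+ 2 <= F0 + H * q]. If [q] is at least 1, the
   right side is at most [(F0 + H) * q], whence the fraction. *)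
pose r := 1 + 2 * (F0 + H) / Lmin.
have [C C_ge0 approx] := f_quad (K + r).
have frac_ge0 : 0 <= 2 * (F0 + H) / Lmin.
  by rewrite divr_ge0 // ?mulr_ge0 ?addr_ge0 // ltW.
have small_trial L k u : Lmin <= L -> Argmin (prox_model f P L (xs k)) u ->
    `|u - xs k| <= r.
  move=> leL /(prox_argmin (Sxs k))[Su /(_ _ (Sxs k))].
  rewrite subrr !sqr_l2norm (dotpC _ 0) !dotp0l mulr0 => le_u.
  set q := `|u - xs k|; have q_ge0 : 0 <= q by exact: normr_ge0.
  have q_sq : q ^+ 2 <= dotp (u - xs k) (u - xs k).
    by rewrite -sqr_l2norm ler_sqr ?nnegrE ?sqrtr_ge0 // norm_le_l2norm.
  have : `|dotp (g (xs k)) (u - xs k)| <= H * q.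
    apply: (le_trans (ler_norm_dotp _ _)).
    by rewrite ler_wpM2r // ler_wpM2l // gG.
  rewrite ler_norml => /andP[lin _].
  have le1 : Lmin / 2 * q ^+ 2 <= F0 + H * q.
    have : Lmin / 2 * q ^+ 2 <= L / 2 * dotp (u - xs k) (u - xs k).
      by rewrite ler_pM ?sqr_ge0 //; lra.
    by have := Phi_ge0 u; have := PhiF0 k; lra.
  rewrite leNgt; apply/negP => lt_rq.
  have fracE : Lmin * (2 * (F0 + H) / Lmin) = 2 * (F0 + H) by field; lra.
  have q_gt0 : 0 < q by apply: lt_trans lt_rq; rewrite /r; lra.
  have : 0 < Lmin / 2 * q * (q - r) by rewrite !mulr_gt0 //; lra.
  have -> : Lmin / 2 * q * (q - r)
      = Lmin / 2 * q ^+ 2 - Lmin / 2 * q - (Lmin * (2 * (F0 + H) / Lmin)) / 2 * q.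
    by rewrite /r; field; lra.
  rewrite fracE.
  have : 0 <= F0 * (q - 1) by rewrite mulr_ge0 //; rewrite /r in lt_rq; lra.
  have : 0 < Lmin / 2 * q by rewrite mulr_gt0 //; lra.
  lra.
(* Adding the prox inequality to the descent lemma leaves a decrease of [L / 2 - C] times the
   squared step, at least [c / 2] times it. *)
have large_accept L k u : Lmin <= L -> 2 * C + c <= L ->
    Argmin (prox_model f P L (xs k)) u -> npg_accept f P c M xs k u.
  move=> leL geL argmin; have u_near := small_trial _ _ _ leL argmin.
  have [Su /(_ _ (Sxs k))] := prox_argmin (Sxs k) argmin.
  rewrite subrr !sqr_l2norm (dotpC _ 0) !dotp0l mulr0 => le_u.
  apply: npg_accept_sufficient => //; rewrite sqr_l2norm.
  have r_ge0 : 0 <= r by rewrite /r; lra.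
  have xKr : `|xs k| <= K + r by apply: (le_trans (xsK k)); lra.
  have uKr : `|u| <= K + r.
    by rewrite -[u](subrK (xs k)) addrC (le_trans (ler_normD _ _)) // lerD.
  have := approx _ _ xKr uKr; rewrite ler_norml => /andP[_ le_f].
  have : C * `|u - xs k| ^+ 2 <= C * dotp (u - xs k) (u - xs k).
    by rewrite ler_wpM2l // -sqr_l2norm ler_sqr ?nnegrE ?sqrtr_ge0 // norm_le_l2norm.
  have : 0 <= (L - (2 * C + c)) * dotp (u - xs k) (u - xs k).
    by rewrite mulr_ge0 ?dotp_ge0 // subr_ge0.
  lra.
(* The first term covers acceptance at the first trial, the second acceptance after a rejection. *)
exists (`|Lmax| + tau * (2 * C + c)) => k.
have [L0 [j [u [/andP[leL0 geL0] argmin rejected _ ->]]]] := step k.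
have tau_ge0 : 0 <= tau by lra.
have Lbar_ge0 : 0 <= tau * (2 * C + c) by rewrite mulr_ge0 //; lra.
exists (tau ^+ j * L0); last exact: argmin.
rewrite mulr_ge0 ?exprn_ge0 //=; last lra.
case: j argmin rejected => [|j] argmin rejected.
  by rewrite expr0 mul1r; have := ler_norm Lmax; lra.
have lt_L : tau ^+ j * L0 < 2 * C + c.
  rewrite ltNge; apply/negP => geL; apply: (rejected j) => //.
  apply: large_accept geL (argmin j (leqnSn j)).
  apply: (le_trans leL0); rewrite ler_peMl //; first lra.
  by rewrite exprn_ege1 // ltW.
rewrite exprS -mulrA; apply: ler_wpDl => //.
by rewrite ler_wpM2l // ltW.
Qed.

(** The penalty and the polyhedron enter only through [quad_approx], nonnegativity and closedness,
    so the argument runs for abstract [f] and [S]. *)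
Theorem npg_convergence (Lmin Lmax tau c : R) M (x0 : 'cV[R]_n) xs :
  continuous Phi -> closed S ->
  (forall alpha, bounded_set (S `&` [set y | Phi y <= alpha])) ->
  0 < Lmin -> 1 < tau -> 0 < c -> S x0 ->
  npg_sequence f P Lmin Lmax tau c M x0 xs ->
  bounded_set (range xs) /\
  forall a, cluster (xs k @[k --> \oo]) a -> first_order_stationary f P a.
Proof.
move=> Phi_cont S_closed level_bounded Lmin_gt0 tau_gt1 c_gt0 Sx0 [xs0 step].
(* The window values are finite once all earlier iterates are feasible, hence the strong induction
   for feasibility. *)
have next k : (forall i, (i <= k)%N -> S (xs i)) ->
    S (xs k.+1) /\ exists2 i, (k - M <= i <= k)%N &
      f (xs k.+1) + Phi (xs k.+1) <=
        f (xs i) + Phi (xs i) - c / 2 * l2norm (xs k.+1 - xs k) ^+ 2.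
  move=> Sxs; have [L0 [j [u [_ _ _ accept ->]]]] := step k.
  exact: npg_accept_window accept.
have Sxs k : S (xs k).
  have [N leN] := ubnP k; elim: N => // N IH in k leN *.
  case: k leN => [|k] leN; first by rewrite xs0.
  by have [] := next k (fun i le_ik => IH i (leq_ltn_trans le_ik leN)).
pose F k := f (xs k) + Phi (xs k).
pose e k := c / 2 * l2norm (xs k.+1 - xs k) ^+ 2.
have e_ge0 k : 0 <= e k by rewrite mulr_ge0 ?sqr_ge0 //; lra.
have descent k : exists2 i, (k - M <= i <= k)%N & F k.+1 <= F i - e k.
  by have [] := next k (fun i _ => Sxs i).
have F_leF0 := nonmonotone_descent_le e_ge0 descent.
have Phi_leF0 k : Phi (xs k) <= F 0%N.
  by have := F_leF0 k; rewrite {1}/F; have := f_ge0 (xs k); lra.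
have [K xsK] : exists K, forall k, `|xs k| <= K.
  have [K [_ leK]] := level_bounded (F 0%N).
  (* [bounded_set] provides a bound for every real strictly above [K]. *)
  exists (K + 1) => k; apply: leK; first by rewrite ltrDl.
  by split; [exact: Sxs | exact: Phi_leF0].
split.
  exists K; split; first exact: num_real.
  by move=> K' ltK _ [k _ <-]; apply: (le_trans (xsK k)); exact: ltW.
have Psi_cont : continuous (fun y => f y + Phi y).
  have f_cont : continuous f.
    by apply: local_lipschitz_continuous; exact: quad_approx_lipschitz_fun f_quad.
  by move=> y; exact: (cvgD (f_cont y) (Phi_cont y)).
have c2 : 0 < c / 2 by lra.
have sq_le_e k : c / 2 * `|xs k.+1 - xs k| ^+ 2 <= e k.
  by rewrite ler_pM2l // ler_sqr ?nnegrE ?sqrtr_ge0 // norm_le_l2norm.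
have small_step k d : 0 < d -> e k < c / 2 * d ^+ 2 -> `|xs k.+1 - xs k| < d.
  move=> d_gt0 /(le_lt_trans (sq_le_e k)); rewrite ltr_pM2l // ltr_sqr ?nnegrE //.
  exact: ltW.
have e_cvg0 : e @ \oo --> 0.
  apply: (nonmonotone_descent_cvg0 (F := F)) e_ge0 descent _ => [k|eps eps_gt0].
    by rewrite addr_ge0.
  have [d d_gt0 unif] :=
    compact_unif_continuous (@bounded_cV_compact R n K) Psi_cont eps_gt0.
  (* Below this threshold [e k] forces a step shorter than the modulus [d]. *)
  exists (c / 2 * d ^+ 2) => [|k /(small_step _ _ d_gt0) lt_d].
    by rewrite mulr_gt0 // exprn_gt0.
  have := unif _ _ (xsK k.+1) lt_d; rewrite ltr_norml => /andP[_].
  by rewrite /F; lra.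
move=> a /cluster_seq_sub[ks ks_ge ks_near].
have [Lbar stepsize] := npg_stepsize_bounded Lmin_gt0 tau_gt1 c_gt0 Sxs xsK Phi_leF0 step.
have /choice[L L_spec] : forall k, exists L, 0 <= L <= Lbar /\
    Argmin (prox_model f P L (xs k)) (xs k.+1).
  by move=> k; have [L] := stepsize k; exists L.
pose d j := `|xs (ks j).+1 - xs (ks j)|.
have d_cvg0 : d @ \oo --> 0.
  apply/cvgrPdist_lt => eps eps_gt0.
  have bound_gt0 : 0 < c / 2 * eps ^+ 2 by rewrite mulr_gt0 // exprn_gt0.
  have /cvgrPdist_lt/(_ _ bound_gt0)[N _ e_small] := e_cvg0.
  exists N => // j /= le_Nj; rewrite sub0r normrN normr_id.
  apply: small_step => //; apply: le_lt_trans (e_small (ks j) _).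
    by rewrite sub0r normrN ler_norm.
  exact: leq_trans le_Nj (ks_ge j).
(* The subgradients live at the successors of the chosen iterates, so these must converge to [a] as
   well. *)
have next_cvg : xs (ks j).+1 @[j --> \oo] --> a.
  apply: (@cvg_dist_le _ _ _ _ (fun j => d j + harmonic j)) => [j|].
    rewrite -[xs _ - a](subrKA (xs (ks j))); apply: (le_trans (ler_normD _ _)).
    by rewrite lerD2l.
  by rewrite -(addr0 0); apply: cvgD d_cvg0 _; exact: cvg_harmonic.
have Sa : S a.
  apply: (closed_cvg S S_closed _ _ next_cvg).
  by apply: nearW => j; exact: Sxs.
(* This radius covers both the iterates and the limit. *)
have [C C_ge0 lip] := quad_approx_lipschitz f_quad (Num.max K `|a|).
exists (- g a); last by rewrite /= (quad_approx_gradient f_quad) subrr.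
split; first by rewrite constrained_in.
exists (fun j => xs (ks j).+1).
exists (fun j => - (g (xs (ks j)) + L (ks j) *: (xs (ks j).+1 - xs (ks j)))).
split=> [//| | |j].
- under eq_fun do rewrite constrained_in //.
  rewrite constrained_in //; apply: cvg_EFin; first exact: nearW.
  exact: cvg_comp next_cvg (Phi_cont a).
(* The gradient difference is controlled by [harmonic j], the proximal term by the bounded [L] times
   the vanishing step. *)
- apply: (@cvg_dist_le _ _ _ _ (fun j => C * harmonic j + Lbar * d j)) => [j|].
    rewrite -opprD normrN addrAC; apply: (le_trans (ler_normD _ _)); rewrite lerD //.
      apply: (@le_trans _ _ (C * `|xs (ks j) - a|)); last by rewrite ler_wpM2l.
      by apply: lip; rewrite le_max ?lexx ?orbT // xsK.
    have [/andP[L_ge0 leL] _] := L_spec (ks j).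
    by rewrite normrZ ger0_norm // ler_wpM2r.
  have -> : 0 = C * 0 + Lbar * 0 :> R by rewrite !mulr0 addr0.
  apply: cvgD; apply: cvgM;
    [exact: cvg_cst|exact: cvg_harmonic|exact: cvg_cst|exact: d_cvg0].
- have [_ argmin] := L_spec (ks j).
  exact: prox_regular_subgradient argmin.
Qed.

End NPGConvergence.

(** * Polyhedra and the penalized problem *)

Lemma closed_polyhedron (R : realType) p n (D : 'M[R]_(p, n)) (d : 'cV[R]_p) :
  closed (polyhedron D d).
Proof.
have rowE i x : (D *m x) i 0 = dotp (row i D)^T x.
  by rewrite mxE; apply: eq_bigr => j _; rewrite !mxE.
have -> : polyhedron D d
    = \bigcap_(i in [set: 'I_p]) [set x | dotp (row i D)^T x <= d i 0].
  apply/seteqP; split=> x xD i => [_|]; first by rewrite /= -rowE; exact: xD.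
  by rewrite rowE; exact: xD.
apply: closed_bigI => i _.
(* A linear form is affine with zero offset, so the Lipschitz bound already proved applies. *)
have cont : continuous (dotp (row i D)^T).
  apply: local_lipschitz_continuous.
  apply: quad_approx_lipschitz_fun (quad_approx_affine (b := 0) _).
  by move=> x; rewrite addr0.
exact: closed_comp (fun x _ => cont x) (@closed_le _ (d i 0)).
Qed.

Theorem theorem4p1 (R : realType) (n m l p : nat)
    (Phi : 'cV[R]_n -> R)
    (A : 'M[R]_(m, n)) (b : 'cV[R]_m) (sigma : R)
    (B : 'M[R]_(l, n)) (h : 'cV[R]_l)
    (D : 'M[R]_(p, n)) (d : 'cV[R]_p)
    (S1 := polyhedron D d) (S2 := residual_set A b sigma B h)
    (Phi_ge0 : forall x, 0 <= Phi x)
    (Phi_continuous : continuous Phi)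
    (A_full_row_rank : row_free A)
    (sigma_ge0 : 0 <= sigma)
    (slater : exists2 x, (S1 `&` S2) x & l2norm (A *m x - b) < sigma)
    (level_bounded : forall alpha : R,
       bounded_set (S1 `&` [set x | Phi x <= alpha]))
    (lambda mu : R) (lambda_gt0 : 0 < lambda) (mu_gt0 : 0 < mu)
    (f := penalty A b sigma B h lambda mu)
    (P := fun x => ((Phi x)%:E + set_indicator S1 x)%E)
    (Lmin Lmax tau c : R) (M : nat)
    (Lmin_gt0 : 0 < Lmin) (Lmin_le_Lmax : Lmin <= Lmax)
    (tau_gt1 : 1 < tau) (c_gt0 : 0 < c)
    (x0 : 'cV[R]_n) (x0_S1 : S1 x0)
    (x : nat -> 'cV[R]_n)
    (x_npg : npg_sequence f P Lmin Lmax tau c M x0 x) :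
  bounded_set (range x) /\
  (forall xstar : 'cV[R]_n, cluster (x k @[k --> \oo]) xstar ->
     first_order_stationary f P xstar).
Proof.
have [g f_quad] :=
  penalty_quad_approx A b sigma B h (ltW lambda_gt0) mu_gt0.
apply: (npg_convergence f_quad _ Phi_ge0 Phi_continuous _ level_bounded
  Lmin_gt0 tau_gt1 c_gt0 x0_S1 x_npg) => [y|].
  by apply: penalty_ge0 => //; exact: ltW.
exact: closed_polyhedron.
Qed.
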